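(* Let $\mathcal{H}$ be a complex Hilbert space and let $A\in\mathcal{B}(\mathcal{H})$. Then for all $\alpha\in[0,1]$, $$w^2(A)\le\left\|\int_0^1\left((1-t)\left(\alpha|A|^2+(1-\alpha)|A^*|^2\right)+t\,w^2(A)I\right)^2dt\right\|^{1/2}\le\left\|\alpha|A|^2+(1-\alpha)|A^*|^2\right\|.$$
   Context: $\mathcal{B}(\mathcal{H})$ is the set of bounded linear operators on $\mathcal{H}$, $A^*$ is the adjoint of $A$, $|A|=(A^*A)^{1/2}$, $I$ is the identity operator, and $\|\cdot\|$ is the operator norm. The numerical radius is $w(A)=\sup\{|\langle Ax,x\rangle| : x\in\mathcal{H},\ \|x\|=1\}$, and $w^2(A)=(w(A))^2$. The integral is the integral over $[0,1]$ of a norm-continuous operator-valued function. *)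

(* Defs.v *)
From Stdlib Require Import Reals Lra Classical ClassicalEpsilon.
From Stdlib Require Import FunctionalExtensionality PropExtensionality.
From Coquelicot Require Import Coquelicot.
Open Scope R_scope.

(** Complex Hilbert spaces: complete complex normed spaces whose norm comes
    from an inner product.  The inner product is linear in its first argument,
    and [inner_norm] makes it positive definite. *)

Record HilbertSpace := {
  hspace :> NormedModule C_AbsRing;
  inner : hspace -> hspace -> C;
  inner_plus_l : forall x y z, inner (plus x y) z = Cplus (inner x z) (inner y z);
  inner_scal_l : forall (k : C_AbsRing) x y,
    inner (scal k x) y = Cmult k (inner x y);
  inner_conj : forall x y, inner y x = Cconj (inner x y);
  inner_norm : forall x, inner x x = RtoC (norm x ^ 2);
  hspace_complete : forall F : (hspace -> Prop) -> Prop,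
    ProperFilter F -> cauchy F ->
    exists x : hspace, forall eps : posreal, F (ball x eps)
}.

Arguments inner {h} x y.

(** [is_linear] in Coquelicot is linearity together with boundedness. *)
Record BOp (H : HilbertSpace) := mkBOp {
  bop_fun :> H -> H;
  bop_linear : is_linear bop_fun
}.

Arguments mkBOp {H} bop_fun bop_linear.
Arguments bop_fun {H} b x.
Arguments bop_linear {H} b.

(** Suprema are taken in the extended reals; those below are finite, except
    that the one defining [numrad] is over the empty set when [H] is the zero
    space, and then [numrad A = real m_infty = 0]. *)
Definition opnorm {H : HilbertSpace} (A : BOp H) : R :=
  real (Lub_Rbar (fun r => exists x : H, norm x <= 1 /\ r = norm (A x))).

Definition numrad {H : HilbertSpace} (A : BOp H) : R :=
  real (Lub_Rbar (fun r =>
    exists x : H, norm x = 1 /\ r = Cmod (inner (A x) x))).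

Section Operators.

Context {H : HilbertSpace}.
Implicit Types A B : BOp H.

Lemma bop_ext A B : (forall x, A x = B x) -> A = B.
Proof.
destruct A as [f hf], B as [g hg]; simpl; intros E.
assert (f = g) by (apply functional_extensionality; exact E).
subst g; f_equal; apply proof_irrelevance.
Qed.

Lemma is_linear_add A B : is_linear (fun x : H => plus (A x) (B x)).
Proof.
apply (is_linear_comp (fun x : H => (A x, B x)) (fun p => plus (fst p) (snd p))).
- apply is_linear_prod; apply bop_linear.
- apply is_linear_plus.
Qed.

Lemma is_linear_neg A : is_linear (fun x : H => opp (A x)).
Proof. apply (is_linear_comp A opp); [apply bop_linear | apply is_linear_opp]. Qed.

Lemma is_linear_rscal (r : R) A :
  is_linear (fun x : H => scal (RtoC r : C_AbsRing) (A x)).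
Proof.
apply (is_linear_comp A (fun x : H => scal (RtoC r : C_AbsRing) x)).
- apply bop_linear.
- exact (@is_linear_scal_r C_AbsRing H (RtoC r) Cmult_comm).
Qed.

Definition bop_zero : BOp H := mkBOp (fun _ => zero) is_linear_zero.
Definition bop_plus A B : BOp H := mkBOp _ (is_linear_add A B).
Definition bop_opp A : BOp H := mkBOp _ (is_linear_neg A).
Definition bop_scal (r : R) A : BOp H := mkBOp _ (is_linear_rscal r A).
Definition bop_id : BOp H := mkBOp (fun x => x) is_linear_id.
Definition bop_comp A B : BOp H :=
  mkBOp (fun x => A (B x)) (is_linear_comp B A (bop_linear B) (bop_linear A)).

Lemma bop_plus_comm A B : bop_plus A B = bop_plus B A.
Proof. apply bop_ext; intros x; exact (plus_comm (A x) (B x)). Qed.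

Lemma bop_plus_assoc A B D :
  bop_plus A (bop_plus B D) = bop_plus (bop_plus A B) D.
Proof. apply bop_ext; intros x; exact (plus_assoc (A x) (B x) (D x)). Qed.

Lemma bop_plus_zero_r A : bop_plus A bop_zero = A.
Proof. apply bop_ext; intros x; exact (plus_zero_r (A x)). Qed.

Lemma bop_plus_opp_r A : bop_plus A (bop_opp A) = bop_zero.
Proof. apply bop_ext; intros x; exact (plus_opp_r (A x)). Qed.

End Operators.

Definition bop_AbelianMonoid_mixin (H : HilbertSpace) :=
  AbelianMonoid.Mixin (BOp H) bop_plus bop_zero
    bop_plus_comm bop_plus_assoc bop_plus_zero_r.

Canonical bop_AbelianMonoid (H : HilbertSpace) :=
  AbelianMonoid.Pack (BOp H) (bop_AbelianMonoid_mixin H) (BOp H).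

Definition bop_AbelianGroup_mixin (H : HilbertSpace) :=
  AbelianGroup.Mixin (bop_AbelianMonoid H) bop_opp bop_plus_opp_r.

Canonical bop_AbelianGroup (H : HilbertSpace) :=
  AbelianGroup.Pack (BOp H)
    (AbelianGroup.Class _ (bop_AbelianMonoid_mixin H) (bop_AbelianGroup_mixin H))
    (BOp H).

Section Algebra.

Context {H : HilbertSpace}.
Implicit Types A B : BOp H.

Lemma bop_comp_assoc A B D : bop_comp A (bop_comp B D) = bop_comp (bop_comp A B) D.
Proof. apply bop_ext; intros x; reflexivity. Qed.

Lemma bop_comp_id_r A : bop_comp A bop_id = A.
Proof. apply bop_ext; intros x; reflexivity. Qed.

Lemma bop_comp_id_l A : bop_comp bop_id A = A.
Proof. apply bop_ext; intros x; reflexivity. Qed.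

Lemma bop_comp_plus_l A B D :
  bop_comp (plus A B) D = plus (bop_comp A D) (bop_comp B D).
Proof. apply bop_ext; intros x; reflexivity. Qed.

Lemma bop_comp_plus_r A B D :
  bop_comp A (plus B D) = plus (bop_comp A B) (bop_comp A D).
Proof. apply bop_ext; intros x; apply (linear_plus _ (bop_linear A)). Qed.

Lemma bop_scal_assoc (r s : R) A : bop_scal r (bop_scal s A) = bop_scal (r * s) A.
Proof.
apply bop_ext; intros x; simpl; rewrite scal_assoc, RtoC_mult; reflexivity.
Qed.

Lemma bop_scal_one A : bop_scal 1 A = A.
Proof. apply bop_ext; intros x; exact (scal_one (A x)). Qed.

Lemma bop_scal_distr_l (r : R) A B :
  bop_scal r (plus A B) = plus (bop_scal r A) (bop_scal r B).
Proof. apply bop_ext; intros x; exact (scal_distr_l (RtoC r : C_AbsRing) (A x) (B x)). Qed.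

Lemma bop_scal_distr_r (r s : R) A :
  bop_scal (r + s) A = plus (bop_scal r A) (bop_scal s A).
Proof.
apply bop_ext; intros x; simpl; rewrite RtoC_plus.
exact (scal_distr_r (RtoC r : C_AbsRing) (RtoC s) (A x)).
Qed.

End Algebra.

Definition bop_Ring_mixin (H : HilbertSpace) :=
  Ring.Mixin (bop_AbelianGroup H) bop_comp bop_id bop_comp_assoc
    bop_comp_id_r bop_comp_id_l bop_comp_plus_l bop_comp_plus_r.

Canonical bop_Ring (H : HilbertSpace) :=
  Ring.Pack (BOp H)
    (Ring.Class _ (AbelianGroup.class (bop_AbelianGroup H)) (bop_Ring_mixin H))
    (BOp H).

(** Only real scalars are needed; [RInt] is for real normed modules. *)
Definition bop_ModuleSpace_mixin (H : HilbertSpace) :=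
  ModuleSpace.Mixin R_Ring (bop_AbelianGroup H) bop_scal bop_scal_assoc
    bop_scal_one bop_scal_distr_l bop_scal_distr_r.

Canonical bop_ModuleSpace (H : HilbertSpace) :=
  ModuleSpace.Pack R_Ring (BOp H)
    (ModuleSpace.Class _ _ _ (bop_ModuleSpace_mixin H)) (BOp H).

Section Norm.

Context {H : HilbertSpace}.
Implicit Types A B : BOp H.

Lemma norm_rscal (r : R) (x : H) :
  norm (scal (RtoC r : C_AbsRing) x) <= Rabs r * norm x.
Proof.
eapply Rle_trans; [exact (@norm_scal C_AbsRing H (RtoC r) x)|].
change (Cmod (RtoC r) * norm x <= Rabs r * norm x).
rewrite Cmod_R; lra.
Qed.

Lemma opnorm_lub A :
  is_lub_Rbar (fun r => exists x : H, norm x <= 1 /\ r = norm (A x))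
    (Finite (opnorm A)).
Proof.
unfold opnorm.
set (E := fun r => _).
pose proof (Lub_Rbar_correct E) as L.
destruct (linear_norm _ (bop_linear A)) as [M [M0 HM]].
assert (E0 : E 0).
{ exists zero; split.
  - rewrite norm_zero; lra.
  - rewrite (linear_zero _ (bop_linear A)), norm_zero; reflexivity. }
assert (EM : is_ub_Rbar E (Finite M)).
{ intros r [x [Hx ->]]; simpl.
  eapply Rle_trans; [apply HM|].
  pose proof (norm_ge_0 x); nra. }
assert (F : is_finite (Lub_Rbar E)).
{ pose proof (proj1 L 0 E0) as L0; pose proof (proj2 L _ EM) as LM.
  destruct (Lub_Rbar E); simpl in *; try tauto; reflexivity. }
rewrite F; exact L.
Qed.

Lemma opnorm_ub A (x : H) : norm x <= 1 -> norm (A x) <= opnorm A.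
Proof. intros Hx; apply (proj1 (opnorm_lub A)); exists x; auto. Qed.

Lemma opnorm_ge_0 A : 0 <= opnorm A.
Proof.
apply Rle_trans with (norm (A zero)); [apply norm_ge_0|].
apply opnorm_ub; rewrite norm_zero; lra.
Qed.

Lemma norm_opnorm A (x : H) : norm (A x) <= opnorm A * norm x.
Proof.
destruct (Req_dec (norm x) 0) as [E|E].
- rewrite (norm_eq_zero x E), (linear_zero _ (bop_linear A)), !norm_zero; lra.
- assert (P : 0 < norm x) by (pose proof (norm_ge_0 x); lra).
  set (y := scal (RtoC (/ norm x) : C_AbsRing) x).
  assert (Ey : x = scal (RtoC (norm x) : C_AbsRing) y).
  { unfold y; rewrite scal_assoc.
    replace (mult (RtoC (norm x) : C_AbsRing) (RtoC (/ norm x)))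
      with (one : C_AbsRing); [symmetry; apply (scal_one x)|].
    change (RtoC 1 = Cmult (RtoC (norm x)) (RtoC (/ norm x))).
    rewrite <- RtoC_mult; f_equal; field; exact E. }
  assert (Ny : norm y <= 1).
  { eapply Rle_trans; [apply norm_rscal|].
    rewrite Rabs_pos_eq by (left; apply Rinv_0_lt_compat; exact P).
    rewrite Rinv_l by exact E; lra. }
  rewrite Ey at 1.
  rewrite (linear_scal _ (bop_linear A)).
  eapply Rle_trans; [apply norm_rscal|].
  rewrite Rabs_pos_eq by lra.
  pose proof (opnorm_ub A y Ny); nra.
Qed.

Lemma opnorm_le A (M : R) :
  0 <= M -> (forall x, norm (A x) <= M * norm x) -> opnorm A <= M.
Proof.
intros M0 HM.
apply (proj2 (opnorm_lub A) (Finite M)).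
intros r [x [Hx ->]]; simpl.
eapply Rle_trans; [apply HM|].
pose proof (norm_ge_0 x); nra.
Qed.

Lemma opnorm_triangle A B : opnorm (plus A B) <= opnorm A + opnorm B.
Proof.
apply opnorm_le.
- pose proof (opnorm_ge_0 A); pose proof (opnorm_ge_0 B); lra.
- intros x; eapply Rle_trans; [apply (norm_triangle (A x) (B x))|].
  pose proof (norm_opnorm A x); pose proof (norm_opnorm B x); lra.
Qed.

Lemma opnorm_scal (r : R) A : opnorm (scal r A) <= Rabs r * opnorm A.
Proof.
apply opnorm_le.
- apply Rmult_le_pos; [apply Rabs_pos | apply opnorm_ge_0].
- intros x; eapply Rle_trans; [apply (norm_rscal r (A x))|].
  pose proof (norm_opnorm A x); pose proof (Rabs_pos r); nra.
Qed.

Lemma opnorm_eq_0 A : opnorm A = 0 -> A = zero.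
Proof.
intros E; apply bop_ext; intros x; apply norm_eq_zero.
pose proof (norm_opnorm A x); pose proof (norm_ge_0 (A x)).
rewrite E in *; change (norm (A x) = 0); lra.
Qed.

Lemma opnorm_opp A : opnorm (opp A) = opnorm A.
Proof.
assert (L : forall B, opnorm (opp B) <= opnorm B).
{ intros B; apply opnorm_le; [apply opnorm_ge_0|].
  intros x; change (norm (opp (B x)) <= opnorm B * norm x).
  rewrite norm_opp; apply norm_opnorm. }
apply Rle_antisym; [apply L|].
rewrite <- (opp_opp A) at 1; apply L.
Qed.

Definition bop_ball A (e : R) B : Prop := opnorm (minus B A) < e.

Lemma bop_ball_center A (e : posreal) : bop_ball A e A.
Proof.
unfold bop_ball; rewrite minus_eq_zero.
eapply Rle_lt_trans; [|apply cond_pos].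
apply opnorm_le; [lra|].
intros x; change (norm (zero : H) <= 0 * norm x); rewrite norm_zero; lra.
Qed.

Lemma bop_ball_sym A B e : bop_ball A e B -> bop_ball B e A.
Proof. unfold bop_ball; now rewrite <- opp_minus, opnorm_opp. Qed.

Lemma bop_ball_triangle A B D e1 e2 :
  bop_ball A e1 B -> bop_ball B e2 D -> bop_ball A (e1 + e2) D.
Proof.
unfold bop_ball; intros H1 H2.
rewrite (minus_trans B).
eapply Rle_lt_trans; [apply opnorm_triangle|]; lra.
Qed.

End Norm.

Definition bop_UniformSpace_mixin (H : HilbertSpace) :=
  UniformSpace.Mixin (BOp H) (zero : BOp H) bop_ball
    bop_ball_center bop_ball_sym bop_ball_triangle.

Canonical bop_UniformSpace (H : HilbertSpace) :=
  UniformSpace.Pack (BOp H) (bop_UniformSpace_mixin H) (BOp H).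

Canonical bop_NormedModuleAux (H : HilbertSpace) :=
  NormedModuleAux.Pack R_AbsRing (BOp H)
    (NormedModuleAux.Class R_AbsRing (BOp H)
      (ModuleSpace.class R_Ring (bop_ModuleSpace H)) (bop_UniformSpace_mixin H))
    (BOp H).

Lemma bop_norm_compat1 (H : HilbertSpace) (A B : BOp H) (e : R) :
  opnorm (minus B A) < e -> ball A e B.
Proof. intros h; exact h. Qed.

Lemma bop_norm_compat2 (H : HilbertSpace) (A B : BOp H) (e : posreal) :
  ball A e B -> opnorm (minus B A) < 1 * e.
Proof. rewrite Rmult_1_l; intros h; exact h. Qed.

Definition bop_NormedModule_mixin (H : HilbertSpace) :=
  NormedModule.Mixin R_AbsRing (bop_NormedModuleAux H) opnorm 1
    opnorm_triangle opnorm_scal (bop_norm_compat1 H) (bop_norm_compat2 H)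
    opnorm_eq_0.

Canonical bop_NormedModule (H : HilbertSpace) :=
  NormedModule.Pack R_AbsRing (BOp H)
    (NormedModule.Class R_AbsRing (BOp H) _ (bop_NormedModule_mixin H)) (BOp H).

Section Complete.

Context {H : HilbertSpace}.

Lemma minus_plus_plus {G : AbelianGroup} (a b c d : G) :
  minus (plus a b) (plus c d) = plus (minus a c) (minus b d).
Proof.
unfold minus; rewrite opp_plus, <- !plus_assoc; f_equal.
rewrite !plus_assoc; f_equal; apply plus_comm.
Qed.

Lemma bop_complete (F : (BOp H -> Prop) -> Prop) :
  ProperFilter F -> cauchy F ->
  exists L : BOp H, forall e : posreal, F (ball L e).
Proof.
intros PF CF.
assert (FF : Filter F) by apply filter_filter.
set (G := fun x : H => filtermap (fun A : BOp H => A x) F).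
assert (PG : forall x, ProperFilter (G x)).
{ intros x; apply filtermap_proper_filter; exact PF. }
assert (CG : forall x, cauchy (G x)).
{ intros x e.
  assert (Hd : 0 < e / (norm x + 1)).
  { apply Rdiv_lt_0_compat; [apply cond_pos | pose proof (norm_ge_0 x); lra]. }
  destruct (CF (mkposreal _ Hd)) as [A0 HA0].
  exists (A0 x); unfold G, filtermap.
  eapply filter_imp; [|exact HA0]; intros A HA.
  apply (norm_compat1 (A0 x) (A x)).
  change (norm (minus A A0 x) < e).
  eapply Rle_lt_trans; [apply norm_opnorm|].
  change (opnorm (minus A A0) < e / (norm x + 1)) in HA.
  pose proof (norm_ge_0 x); pose proof (opnorm_ge_0 (minus A A0)).
  apply (Rmult_lt_compat_r (norm x + 1)) in HA; [|lra].
  replace (e / (norm x + 1) * (norm x + 1)) with (pos e) in HA by (field; lra).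
  lra. }
set (l := fun x : H =>
  epsilon (inhabits zero) (fun y : H => forall e : posreal, G x (ball y e))).
assert (Hl : forall x (d : R), 0 < d ->
  F (fun A => norm (minus (A x) (l x)) < d)).
{ intros x d Hd.
  assert (Hd' : 0 < d / @norm_factor _ H).
  { apply Rdiv_lt_0_compat; [exact Hd | apply norm_factor_gt_0]. }
  pose proof (epsilon_spec (inhabits zero) _
    (hspace_complete H (G x) (PG x) (CG x)) (mkposreal _ Hd')) as Hx.
  fold (l x) in Hx; unfold G, filtermap in Hx.
  eapply filter_imp; [|exact Hx]; intros A HA.
  pose proof (norm_compat2 (l x) (A x) (mkposreal _ Hd') HA) as N; simpl in N.
  replace (norm_factor * (d / norm_factor)) with d in N; [exact N|].
  field; apply Rgt_not_eq, norm_factor_gt_0. }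
(* a pointwise bound valid eventually passes to the limit *)
assert (Hle : forall (x y : H) (M : R),
  F (fun A => norm (minus (A x) y) <= M) -> norm (minus (l x) y) <= M).
{ intros x y M HF; apply le_epsilon; intros d Hd.
  destruct (filter_ex _ (filter_and _ _ HF (Hl x d Hd))) as [A [H1 H2]].
  rewrite (minus_trans (A x)).
  eapply Rle_trans; [apply norm_triangle|].
  rewrite <- norm_opp, opp_minus in H2; lra. }
assert (Heq : forall u v : H,
  (forall d, 0 < d -> norm (minus u v) <= d) -> u = v).
{ intros u v E.
  assert (Z : minus u v = zero).
  { apply norm_eq_zero, Rle_antisym; [|apply norm_ge_0].
    apply le_epsilon; intros d Hd; rewrite Rplus_0_l; auto. }
  replace u with (plus (minus u v) v).
  - rewrite Z; apply plus_zero_l.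
  - unfold minus; rewrite <- plus_assoc, plus_opp_l; apply plus_zero_r. }
assert (Ladd : forall x y : H, l (plus x y) = plus (l x) (l y)).
{ intros x y; apply Heq; intros d Hd; apply Hle.
  assert (Hd2 : 0 < d / 2) by lra.
  eapply filter_imp; [|exact (filter_and _ _ (Hl x _ Hd2) (Hl y _ Hd2))].
  intros A [H1 H2].
  rewrite (linear_plus _ (bop_linear A)).
  replace (minus (plus (A x) (A y)) (plus (l x) (l y)))
    with (plus (minus (A x) (l x)) (minus (A y) (l y)))
    by (symmetry; exact (minus_plus_plus (A x) (A y) (l x) (l y))).
  eapply Rle_trans; [apply norm_triangle|]; lra. }
assert (Lscal : forall (k : C_AbsRing) (x : H), l (scal k x) = scal k (l x)).
{ intros k x; apply Heq; intros d Hd; apply Hle.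
  assert (K0 : 0 <= abs k) by apply abs_ge_0.
  assert (Hd2 : 0 < d / (abs k + 1)) by (apply Rdiv_lt_0_compat; lra).
  eapply filter_imp; [|exact (Hl x _ Hd2)]; intros A H1.
  rewrite (linear_scal _ (bop_linear A)).
  eapply Rle_trans; [right; exact (f_equal (@norm C_AbsRing H)
    (eq_sym (scal_minus_distr_l k (A x) (l x))))|].
  eapply Rle_trans; [exact (@norm_scal C_AbsRing H k (minus (A x) (l x)))|].
  pose proof (norm_ge_0 (minus (A x) (l x))).
  apply (Rmult_lt_compat_r (abs k + 1)) in H1; [|lra].
  replace (d / (abs k + 1) * (abs k + 1)) with d in H1 by (field; lra).
  lra. }
assert (Hclose : forall (A0 : BOp H) (e : R), F (ball A0 e) ->
  forall x, norm (minus (l x) (A0 x)) <= e * norm x).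
{ intros A0 e HF x; apply Hle.
  eapply filter_imp; [|exact HF]; intros A HA.
  change (opnorm (minus A A0) < e) in HA.
  change (norm (minus A A0 x) <= e * norm x).
  pose proof (norm_opnorm (minus A A0) x); pose proof (norm_ge_0 x); nra. }
assert (Lbnd : exists M : R, 0 < M /\ forall x, norm (l x) <= M * norm x).
{ destruct (CF (mkposreal 1 Rlt_0_1)) as [A0 HA0]; simpl in HA0.
  exists (1 + opnorm A0); split; [pose proof (opnorm_ge_0 A0); lra|].
  intros x.
  replace (l x) with (plus (minus (l x) (A0 x)) (A0 x)).
  - eapply Rle_trans; [apply norm_triangle|].
    pose proof (Hclose A0 1 HA0 x); pose proof (norm_opnorm A0 x); lra.
  - unfold minus; rewrite <- plus_assoc, plus_opp_l; apply plus_zero_r. }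
set (L := mkBOp l (Build_is_linear l Ladd Lscal Lbnd)).
exists L; intros e.
assert (He : 0 < e / 2) by (pose proof (cond_pos e); lra).
destruct (CF (mkposreal _ He)) as [A0 HA0]; simpl in HA0.
eapply filter_imp; [|exact HA0]; intros A HA.
apply bop_norm_compat1.
change (opnorm (minus A A0) < e / 2) in HA.
assert (HL : opnorm (minus L A0) <= e / 2).
{ apply opnorm_le; [lra|]; intros x; exact (Hclose A0 _ HA0 x). }
rewrite (minus_trans A0).
eapply Rle_lt_trans; [apply opnorm_triangle|].
rewrite <- (opp_minus L A0), opnorm_opp; lra.
Qed.

Definition bop_lim (F : (BOp H -> Prop) -> Prop) : BOp H :=
  epsilon (inhabits zero) (fun L : BOp H => forall e : posreal, F (ball L e)).

Lemma bop_lim_cauchy F :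
  ProperFilter F -> cauchy F -> forall e : posreal, F (ball (bop_lim F) e).
Proof. intros PF CF; exact (epsilon_spec _ _ (bop_complete F PF CF)). Qed.

Lemma bop_lim_close (F1 F2 : (BOp H -> Prop) -> Prop) :
  filter_le F1 F2 -> filter_le F2 F1 -> close (bop_lim F1) (bop_lim F2).
Proof.
intros H1 H2.
assert (F1 = F2) as ->.
{ apply functional_extensionality; intros P.
  apply propositional_extensionality; split; [apply H2 | apply H1]. }
apply close_refl.
Qed.

End Complete.

Definition bop_CompleteSpace_mixin (H : HilbertSpace) :=
  CompleteSpace.Mixin (bop_UniformSpace H) bop_lim bop_lim_cauchy bop_lim_close.

Canonical bop_CompleteSpace (H : HilbertSpace) :=
  CompleteSpace.Pack (BOp H)
    (CompleteSpace.Class _ _ (bop_CompleteSpace_mixin H)) (BOp H).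

Canonical bop_CompleteNormedModule (H : HilbertSpace) :=
  CompleteNormedModule.Pack R_AbsRing (BOp H)
    (CompleteNormedModule.Class R_AbsRing (BOp H)
      (NormedModule.class R_AbsRing (bop_NormedModule H))
      (bop_CompleteSpace_mixin H)) (BOp H).

(** The adjoint and the positive square root are characterised uniquely by the
    predicates below, and exist (for every operator, resp. for every positive
    operator) by standard theorems. *)

Definition is_adjoint {H : HilbertSpace} (A B : BOp H) : Prop :=
  forall x y : H, inner (A x) y = inner x (B y).

Definition adjoint {H : HilbertSpace} (A : BOp H) : BOp H :=
  epsilon (inhabits zero) (is_adjoint A).

(** On a complex space a real-valued quadratic form forces self-adjointness. *)
Definition positive_op {H : HilbertSpace} (A : BOp H) : Prop :=
  forall x : H, Im (inner (A x) x) = 0 /\ 0 <= Re (inner (A x) x).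

Definition op_sqrt {H : HilbertSpace} (A : BOp H) : BOp H :=
  epsilon (inhabits zero) (fun P => positive_op P /\ mult P P = A).

Definition op_abs {H : HilbertSpace} (A : BOp H) : BOp H :=
  op_sqrt (mult (adjoint A) A).

(* Main.v *)
Require Import Defs.
From Stdlib Require Import Reals Lra Lia Psatz Classical ClassicalEpsilon.
From Coquelicot Require Import Coquelicot.
Open Scope R_scope.

(** For a unit vector [x], put [s = |<Ax,x>|^2], [c = w(A)^2] and let [T], [J]
    be the operators of the theorem.  Cauchy-Schwarz applied to [<Ax,x>] and to
    [<x,A*x>] gives [s <= <Tx,x>], hence [c <= ||T||].  The integral evaluates
    to [J = (T^2 + c T + c^2 I) / 3].  Therefore
    [||J|| >= (||Tx||^2 + c <Tx,x> + c^2) / 3 >= (s^2 + c s + c^2) / 3], and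
    letting [s] approach [c] gives [||J|| >= c^2]; the triangle inequality
    gives [||J|| <= ||T||^2].

    The adjoint comes from the Riesz representation theorem, proved by
    minimising [||x||^2 - 2 f x].  The square root of [A*A], normalised to
    [I - Q] with [||Q|| <= 1], is [I - Y], where [Y] is the norm limit of
    [Y_0 = 0], [Y_(n+1) = (Q + Y_n^2) / 2]; the increments of [Y_n] are dominated
    by those of the same iteration for the scalar [Q = 1]. *)

(** * Inner-product identities and the Cauchy-Schwarz inequality *)

Section InnerProduct.

Context {H : HilbertSpace}.
Implicit Types x y z : H.

Lemma inner_plus_r x y z : inner x (plus y z) = Cplus (inner x y) (inner x z).
Proof.
rewrite inner_conj, inner_plus_l, Cplus_conj, <- !inner_conj; reflexivity.
Qed.

Lemma inner_scal_r (k : C_AbsRing) x y :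
  inner x (scal k y) = Cmult (Cconj k) (inner x y).
Proof.
rewrite inner_conj, inner_scal_l, Cmult_conj, <- inner_conj; reflexivity.
Qed.

Lemma re_inner_plus_l x y z : Re (inner (plus x y) z) = Re (inner x z) + Re (inner y z).
Proof. rewrite inner_plus_l; reflexivity. Qed.

Lemma re_inner_plus_r x y z : Re (inner x (plus y z)) = Re (inner x y) + Re (inner x z).
Proof. rewrite inner_plus_r; reflexivity. Qed.

Lemma re_inner_scal_l (r : R) x y :
  Re (inner (scal (RtoC r : C_AbsRing) x) y) = r * Re (inner x y).
Proof. rewrite inner_scal_l; unfold Re; simpl; ring. Qed.

Lemma re_inner_scal_r (r : R) x y :
  Re (inner x (scal (RtoC r : C_AbsRing) y)) = r * Re (inner x y).
Proof. rewrite inner_scal_r; unfold Re; simpl; ring. Qed.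

Lemma re_inner_sym x y : Re (inner y x) = Re (inner x y).
Proof. rewrite inner_conj; reflexivity. Qed.

Lemma re_inner_self x : Re (inner x x) = norm x ^ 2.
Proof. rewrite inner_norm; reflexivity. Qed.

Lemma scal_opp_one_C x : opp x = scal (RtoC (-1) : C_AbsRing) x.
Proof.
transitivity (scal (opp one : C_AbsRing) x); [symmetry; exact (scal_opp_one x)|].
f_equal; change (Copp (RtoC 1) = RtoC (-1)); now rewrite <- RtoC_opp.
Qed.

Lemma norm_sq_plus_scal (t : R) x y :
  norm (plus x (scal (RtoC t : C_AbsRing) y)) ^ 2
  = norm x ^ 2 + 2 * t * Re (inner x y) + t ^ 2 * norm y ^ 2.
Proof.
rewrite <- !re_inner_self, !re_inner_plus_l, !re_inner_plus_r,
  !re_inner_scal_l, !re_inner_scal_r, (re_inner_sym x y).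
ring.
Qed.

Lemma norm_sq_plus x y :
  norm (plus x y) ^ 2 = norm x ^ 2 + 2 * Re (inner x y) + norm y ^ 2.
Proof.
rewrite <- !re_inner_self, !re_inner_plus_l, !re_inner_plus_r, (re_inner_sym x y).
ring.
Qed.

Lemma norm_sq_minus x y :
  norm (minus x y) ^ 2 = norm x ^ 2 - 2 * Re (inner x y) + norm y ^ 2.
Proof. unfold minus; rewrite scal_opp_one_C, norm_sq_plus_scal; ring. Qed.

Lemma norm_sq_scal (r : R) x :
  norm (scal (RtoC r : C_AbsRing) x) ^ 2 = r ^ 2 * norm x ^ 2.
Proof. rewrite <- !re_inner_self, re_inner_scal_l, re_inner_scal_r; ring. Qed.

Lemma re_inner_minus_l x y z :
  Re (inner (minus x y) z) = Re (inner x z) - Re (inner y z).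
Proof. unfold minus; rewrite scal_opp_one_C, re_inner_plus_l, re_inner_scal_l; ring. Qed.

Lemma re_inner_minus_r x y z :
  Re (inner x (minus y z)) = Re (inner x y) - Re (inner x z).
Proof.
rewrite re_inner_sym, re_inner_minus_l, (re_inner_sym x y), (re_inner_sym x z).
reflexivity.
Qed.

Lemma im_inner_minus_l x y z :
  Im (inner (minus x y) z) = Im (inner x z) - Im (inner y z).
Proof.
unfold minus; rewrite scal_opp_one_C, inner_plus_l, inner_scal_l.
unfold Im; simpl; ring.
Qed.

Lemma re_inner_zero_r x : Re (inner x zero) = 0.
Proof.
pose proof (re_inner_plus_r x zero zero) as E.
replace (plus zero zero) with (zero : H) in E by (symmetry; exact (plus_zero_r (zero : H))).
lra.
Qed.

Lemma inner_ext_re x y : (forall z, Re (inner x z) = Re (inner y z)) -> x = y.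
Proof.
intros E.
assert (Z : minus x y = zero).
{ apply norm_eq_zero.
  assert (norm (minus x y) ^ 2 = 0); [|pose proof (norm_ge_0 (minus x y)); nra].
  rewrite <- re_inner_self, re_inner_minus_l, E; ring. }
replace x with (plus (minus x y) y).
- rewrite Z; apply plus_zero_l.
- unfold minus; rewrite <- plus_assoc, plus_opp_l; apply plus_zero_r.
Qed.

Lemma inner_ext_r x y : (forall z, inner z x = inner z y) -> x = y.
Proof.
intros E; apply inner_ext_re; intros z.
rewrite (re_inner_sym z x), (re_inner_sym z y), E; reflexivity.
Qed.

(** The vector ||y|| x - ||x|| y has nonnegative squared norm; expanding it and dividing by 2 ||x||
    ||y|| gives the bound. *)
Lemma re_inner_le x y : Re (inner x y) <= norm x * norm y.
Proof.
pose proof (norm_ge_0 x) as Hx; pose proof (norm_ge_0 y) as Hy.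
destruct (Req_dec (norm x) 0) as [Ex|Ex].
{ rewrite (norm_eq_zero x Ex), re_inner_sym, re_inner_zero_r, norm_zero; lra. }
destruct (Req_dec (norm y) 0) as [Ey|Ey].
{ rewrite (norm_eq_zero y Ey), re_inner_zero_r, norm_zero; lra. }
pose proof (pow2_ge_0 (norm (plus (scal (RtoC (norm y) : C_AbsRing) x)
  (scal (RtoC (- norm x) : C_AbsRing) y)))) as P.
rewrite norm_sq_plus_scal, norm_sq_scal, re_inner_scal_l in P.
assert (0 < norm x * norm y) by (apply Rmult_lt_0_compat; lra).
nra.
Qed.

(** Multiplying x by the conjugate of c = <x,y> turns the inner product into the real number |c|^2,
    so the real-part bound applies; then |c| is cancelled. *)
Lemma cauchy_schwarz x y : Cmod (inner x y) <= norm x * norm y.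
Proof.
set (c := inner x y).
destruct (Req_dec (Cmod c) 0) as [E|E].
{ rewrite E; apply Rmult_le_pos; apply norm_ge_0. }
assert (P : 0 < Cmod c) by (pose proof (Cmod_ge_0 c); lra).
pose proof (re_inner_le (scal (Cconj c : C_AbsRing) x) y) as L.
rewrite inner_scal_l in L; fold c in L.
replace (Re (Cmult (Cconj c) c)) with (Cmod c ^ 2) in L
  by (rewrite Cmod2_alt; destruct c; unfold Re, Im; simpl; ring).
pose proof (@norm_scal C_AbsRing H (Cconj c) x) as N.
change (norm (scal (Cconj c : C_AbsRing) x) <= Cmod (Cconj c) * norm x) in N.
rewrite Cmod_conj in N.
apply Rmult_le_reg_l with (Cmod c); [exact P|].
pose proof (norm_ge_0 y); nra.
Qed.

(** * Riesz representation and the existence of adjoints *)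

Lemma re_inner_eq_inner (u v x y : H) :
  (forall k : C_AbsRing, Re (Cmult k (inner u v)) = Re (Cmult k (inner x y))) ->
  inner u v = inner x y.
Proof.
intros E.
pose proof (E (RtoC 1)) as E1; pose proof (E Ci) as E2.
destruct (inner u v), (inner x y); unfold Re in *; simpl in *; f_equal; lra.
Qed.

(** The first variation of ||x||^2 - 2 f x vanishes at a minimiser z, which reads Re <z,y> = f y.
    The functional is real-linear because it will be the real part of a complex one. *)
Lemma riesz_real (f : H -> R) (M : R) :
  (forall x y, f (plus x y) = f x + f y) ->
  (forall (r : R) x, f (scal (RtoC r : C_AbsRing) x) = r * f x) ->
  (forall x, f x <= M * norm x) ->
  exists z, forall x, f x = Re (inner x z).
Proof.
intros fD fZ fM.
set (Phi := fun x => norm x ^ 2 - 2 * f x).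
(* [completeness] yields suprema, so the infimum m of [Phi] is minus the supremum of [- Phi], which
   is at most M^2 because 2 M r - r^2 <= M^2. *)
set (E := fun r => exists x, r = - Phi x).
assert (Ebd : bound E).
{ exists (M ^ 2); intros r [x ->]; unfold Phi.
  pose proof (fM x); pose proof (pow2_ge_0 (norm x - M)); lra. }
destruct (completeness E Ebd (ex_intro _ _ (ex_intro _ zero eq_refl)))
  as [m' [Hub Hlub]].
set (m := - m').
assert (Hm : forall x, m <= Phi x).
{ intros x; assert (- Phi x <= m') by (apply Hub; exists x; reflexivity).
  unfold m; lra. }
assert (Hne : forall e, 0 < e -> exists x, Phi x < m + e).
{ intros e He; apply NNPP; intros N.
  assert (m' <= m' - e); [|lra].
  apply Hlub; intros r [x ->].
  destruct (Rle_lt_dec (m + e) (Phi x)); [unfold m in *; lra|].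
  exfalso; apply N; exists x; assumption. }
(* Parallelogram law. *)
assert (Hpar : forall x y, norm (minus x y) ^ 2 <= 2 * (Phi x - m) + 2 * (Phi y - m)).
{ intros x y.
  pose proof (Hm (scal (RtoC (/ 2) : C_AbsRing) (plus x y))) as P.
  unfold Phi in *.
  rewrite norm_sq_scal, norm_sq_plus, fZ, fD in P.
  rewrite norm_sq_minus; lra. }
(* The filter generated by the near-minimal sets of [Phi]; by [Hpar] it is Cauchy, and its limit z
   is the candidate minimiser. *)
set (F := fun P : H -> Prop => exists e, 0 < e /\ forall x, Phi x < m + e -> P x).
assert (PF : ProperFilter F).
{ constructor.
  - intros P [e [He HP]]; destruct (Hne e He) as [x Hx]; exists x; auto.
  - constructor.
    + exists 1; split; [lra | auto].
    + intros P Q [e [He HP]] [d [Hd HQ]].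
      exists (Rmin e d); split; [apply Rmin_glb_lt; assumption|].
      intros x Hx; pose proof (Rmin_l e d); pose proof (Rmin_r e d).
      split; [apply HP | apply HQ]; lra.
    + intros P Q PQ [e [He HP]]; exists e; split; auto. }
assert (CF : cauchy F).
{ intros e.
  (* In [Hpar] two points with excess below e^2/4 are at squared distance below e^2. *)
  assert (P2 : 0 < e ^ 2 / 4) by (pose proof (cond_pos e); nra).
  destruct (Hne _ P2) as [x Hx]; exists x, (e ^ 2 / 4); split; [exact P2|].
  intros y Hy; apply (norm_compat1 x y).
  pose proof (Hpar y x) as P; pose proof (cond_pos e).
  pose proof (norm_ge_0 (minus y x)).
  apply Rnot_le_lt; intros L.
  assert (e ^ 2 <= norm (minus y x) ^ 2) by (apply pow_incr; lra); lra. }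
destruct (hspace_complete H F PF CF) as [z Hz].
exists z; intros y.
(* The right-hand side is the formal value of Phi(z + t y) - Phi(z). Rather than continuity of
   [Phi], the proof uses a near-minimal x close to z and compares Phi(x + t y) with Phi(x). *)
assert (Hvar : forall t, 0 <= 2 * t * (Re (inner z y) - f y) + t ^ 2 * norm y ^ 2).
{ intros t; apply Rnot_lt_le; intros Neg.
  set (g := 2 * t * (Re (inner z y) - f y) + t ^ 2 * norm y ^ 2) in *.
  (* Near-minimality of x costs e and replacing x by z costs at most 2 |t| ||y|| e, in total e K;
     with e = - g / K this cancels g exactly. *)
  set (K := 1 + 2 * Rabs t * norm y).
  assert (HK : 0 < K).
  { pose proof (Rabs_pos t); pose proof (norm_ge_0 y); unfold K; nra. }
  assert (He : 0 < - g / K) by (apply Rdiv_lt_0_compat; lra).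
  set (e := - g / K) in *.
  assert (HeK : e * K = - g) by (unfold e; field; lra).
  assert (Hf : 0 < e / @norm_factor _ H).
  { apply Rdiv_lt_0_compat; [exact He | apply norm_factor_gt_0]. }
  assert (Fe : F (fun x => Phi x < m + e)) by (exists e; auto).
  destruct (filter_ex _ (filter_and _ _ Fe (Hz (mkposreal _ Hf)))) as [x [H1 H2]].
  pose proof (norm_compat2 z x (mkposreal _ Hf) H2) as N; simpl in N.
  replace (norm_factor * (e / norm_factor)) with e in N
    by (field; apply Rgt_not_eq, norm_factor_gt_0).
  pose proof (Hm (plus x (scal (RtoC t : C_AbsRing) y))) as P.
  unfold Phi in P, H1; rewrite norm_sq_plus_scal, fD, fZ in P.
  assert (Q : t * Re (inner (minus x z) y) <= Rabs t * norm y * e).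
  { rewrite <- re_inner_scal_r.
    eapply Rle_trans; [apply re_inner_le|].
    pose proof (norm_rscal t y).
    pose proof (norm_ge_0 (minus x z)); pose proof (norm_ge_0 y).
    pose proof (norm_ge_0 (scal (RtoC t : C_AbsRing) y)).
    pose proof (Rabs_pos t).
    rewrite Rmult_comm; apply Rmult_le_compat; lra. }
  rewrite re_inner_minus_l in Q.
  unfold g, K in *; nra. }
rewrite re_inner_sym.
set (d := Re (inner z y) - f y) in *.
assert (d = 0); [|unfold d in *; lra].
assert (Hn : 0 <= norm y ^ 2) by apply pow2_ge_0.
set (n := norm y ^ 2) in *.
(* This t makes the variation a strictly negative multiple of d^2; the +1 keeps the denominator
   nonzero when y = 0. *)
pose proof (Hvar (- d / (n + 1))) as V.
replace (2 * (- d / (n + 1)) * d + (- d / (n + 1)) ^ 2 * n)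
  with (- (d ^ 2 * ((n + 2) / (n + 1) ^ 2))) in V by (field; lra).
assert (0 < (n + 2) / (n + 1) ^ 2) by (apply Rdiv_lt_0_compat; nra).
apply NNPP; intros N; assert (0 < d ^ 2) by (apply pow2_gt_0; exact N); nra.
Qed.

(** Take x = z and cancel ||z||. Here z is the future value of the adjoint at y, so the bound is
    available before the adjoint is known to be an operator. *)
Lemma adjoint_bound (A : BOp H) y z :
  (forall x, inner (A x) y = inner x z) -> norm z <= opnorm A * norm y.
Proof.
intros E.
assert (S : norm z ^ 2 <= opnorm A * norm z * norm y).
{ rewrite <- re_inner_self, <- E.
  eapply Rle_trans; [apply re_inner_le|].
  apply Rmult_le_compat_r; [apply norm_ge_0 | apply norm_opnorm]. }
pose proof (norm_ge_0 z); pose proof (norm_ge_0 y); pose proof (opnorm_ge_0 A).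
destruct (Req_dec (norm z) 0); [nra|].
apply Rmult_le_reg_l with (norm z); nra.
Qed.

Lemma adjoint_exists (A : BOp H) : exists B : BOp H, is_adjoint A B.
Proof.
assert (Ex : forall y, exists z, forall x, inner (A x) y = inner x z).
{ intros y.
  destruct (riesz_real (fun x => Re (inner (A x) y)) (opnorm A * norm y)) as [z Hz].
  - intros u v; rewrite (linear_plus _ (bop_linear A)); apply re_inner_plus_l.
  - intros r u; rewrite (linear_scal _ (bop_linear A)); apply re_inner_scal_l.
  - intros u; eapply Rle_trans; [apply re_inner_le|].
    pose proof (norm_opnorm A u); pose proof (norm_ge_0 y); nra.
  (* Riesz matches real parts only; applying it to k x for every complex k recovers the full inner
     product. *)
  - exists z; intros x; apply re_inner_eq_inner; intros k.
    pose proof (Hz (scal k x)) as E.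
    rewrite (linear_scal _ (bop_linear A)), !inner_scal_l in E; exact E. }
set (b := fun y => epsilon (inhabits zero) (fun z => forall x, inner (A x) y = inner x z)).
assert (Hb : forall y x, inner (A x) y = inner x (b y)).
{ intros y; exact (epsilon_spec (inhabits zero) _ (Ex y)). }
assert (L : is_linear b).
{ constructor.
  - intros u v; apply inner_ext_r; intros x.
    rewrite inner_plus_r, <- !Hb, inner_plus_r; reflexivity.
  - intros k u; apply inner_ext_r; intros x.
    rewrite inner_scal_r, <- !Hb, inner_scal_r; reflexivity.
  (* [is_linear] asks for a strictly positive constant, hence the +1. *)
  - exists (opnorm A + 1); split; [pose proof (opnorm_ge_0 A); lra|].
    intros u.
    pose proof (adjoint_bound A u (b u) (Hb u)); pose proof (norm_ge_0 u); lra. }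
exists (mkBOp b L); intros x y; apply Hb.
Qed.

Lemma adjoint_correct (A : BOp H) : is_adjoint A (adjoint A).
Proof. exact (epsilon_spec (inhabits zero) _ (adjoint_exists A)). Qed.

Lemma is_adjoint_re (A B : BOp H) :
  (forall x y, Re (inner (A x) y) = Re (inner x (B y))) -> is_adjoint A B.
Proof.
intros E x y; apply re_inner_eq_inner; intros k.
pose proof (E (scal k x) y) as Ek.
rewrite (linear_scal _ (bop_linear A)), !inner_scal_l in Ek; exact Ek.
Qed.

End InnerProduct.

(** * Extensionality and linearity of operators, with automation for operator identities *)

Section OperatorCalculus.

Context {H : HilbertSpace}.
Implicit Types A B D Q U V : BOp H.

Lemma bop_ext_re A B :
  (forall x z : H, Re (inner (A x) z) = Re (inner (B x) z)) -> A = B.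
Proof.
intros E; apply bop_ext; intros x; apply inner_ext_re; intros z; apply E.
Qed.

Lemma bop_map_plus A (x y : H) : A (plus x y) = plus (A x) (A y).
Proof. apply (linear_plus _ (bop_linear A)). Qed.

Lemma bop_map_scal A (k : C_AbsRing) (x : H) : A (scal k x) = scal k (A x).
Proof. apply (linear_scal _ (bop_linear A)). Qed.

Lemma bop_map_minus A (x y : H) : A (minus x y) = minus (A x) (A y).
Proof.
unfold minus; rewrite bop_map_plus, !scal_opp_one_C, bop_map_scal; reflexivity.
Qed.

End OperatorCalculus.

(* The same operation on operators is reached through several canonical
   structures, so it is recognised by [match] and unfolded by conversion. *)
Ltac bop_unfold :=
  repeat match goal with
  | |- context [@bop_fun ?H ?X ?x] =>
    lazymatch X with
    | @plus _ ?A ?B => change (@bop_fun H X x) with (plus (@bop_fun H A x) (@bop_fun H B x))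
    | @minus _ ?A ?B => change (@bop_fun H X x) with (minus (@bop_fun H A x) (@bop_fun H B x))
    | @mult _ ?A ?B => change (@bop_fun H X x) with (@bop_fun H A (@bop_fun H B x))
    | @scal _ _ ?r ?A =>
      change (@bop_fun H X x) with (scal (RtoC r : C_AbsRing) (@bop_fun H A x))
    | @one _ => change (@bop_fun H X x) with (x : H)
    end
  end.

Ltac bop_expand :=
  repeat progress (bop_unfold;
    rewrite ?bop_map_plus, ?bop_map_minus, ?bop_map_scal,
      ?re_inner_plus_l, ?re_inner_minus_l, ?re_inner_scal_l,
      ?re_inner_plus_r, ?re_inner_minus_r, ?re_inner_scal_r).

(** Testing against arbitrary vectors reduces an operator identity to a scalar one in which the real
    parts of inner products are atoms for [field]. *)
Ltac bop_ring := apply bop_ext_re; intros ? ?; bop_expand; field.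

(** * Positive square roots by norm-convergent iteration *)

Section SquareRoot.

Context {H : HilbertSpace}.
Implicit Types A B D Q U V : BOp H.

Lemma opnorm_mult A B : opnorm (mult A B) <= opnorm A * opnorm B.
Proof.
pose proof (opnorm_ge_0 A); pose proof (opnorm_ge_0 B).
apply opnorm_le; [now apply Rmult_le_pos|]; intros x; bop_unfold;
eapply Rle_trans; [apply norm_opnorm|].
rewrite Rmult_assoc; apply Rmult_le_compat_l; [assumption | apply norm_opnorm].
Qed.

Lemma opnorm_minus_sym A B : opnorm (minus A B) = opnorm (minus B A).
Proof. rewrite <- opp_minus; apply opnorm_opp. Qed.

(** The splitting A^2 - B^2 = A (A - B) + (A - B) B holds for noncommuting A and B. *)
Lemma opnorm_square_minus A B :
  opnorm (minus (mult A A) (mult B B)) <= (opnorm A + opnorm B) * opnorm (minus A B).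
Proof.
replace (minus (mult A A) (mult B B))
  with (plus (mult A (minus A B)) (mult (minus A B) B) : BOp H) by bop_ring.
eapply Rle_trans; [apply opnorm_triangle|].
pose proof (opnorm_mult A (minus A B)); pose proof (opnorm_mult (minus A B) B); lra.
Qed.

Lemma opnorm_le_minus A B : opnorm A <= opnorm B + opnorm (minus A B).
Proof.
replace A with (plus B (minus A B) : BOp H) at 1 by bop_ring.
apply opnorm_triangle.
Qed.

Lemma opnorm_eq_limit A B :
  (forall e, 0 < e -> opnorm (minus A B) <= e) -> A = B.
Proof.
intros E.
assert (Z : minus A B = zero).
{ apply opnorm_eq_0, Rle_antisym; [|apply opnorm_ge_0].
  apply le_epsilon; intros e He; rewrite Rplus_0_l; auto. }
replace A with (plus (minus A B) B) by bop_ring.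
rewrite Z; apply plus_zero_l.
Qed.

(* [I - Y] is a square root of [I - Q] exactly when [Y = (Q + Y^2) / 2]. *)
Fixpoint sqrt_iter Q (n : nat) : BOp H :=
  match n with
  | O => zero
  | S n => scal (/ 2) (plus Q (mult (sqrt_iter Q n) (sqrt_iter Q n)))
  end.

Fixpoint sqrt_iter_one (n : nat) : R :=
  match n with
  | O => 0
  | S n => / 2 * (1 + sqrt_iter_one n ^ 2)
  end.

Lemma sqrt_iter_one_bounds n : 0 <= sqrt_iter_one n <= 1.
Proof. induction n as [|n IH]; simpl; nra. Qed.

Lemma sqrt_iter_one_incr n : sqrt_iter_one n <= sqrt_iter_one (S n).
Proof. simpl; pose proof (sqrt_iter_one_bounds n); nra. Qed.

Lemma opnorm_zero : opnorm (zero : BOp H) = 0.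
Proof. exact (@norm_zero R_AbsRing (bop_NormedModule H)). Qed.

Lemma opnorm_half A : opnorm (scal (/ 2) A) <= / 2 * opnorm A.
Proof.
eapply Rle_trans; [apply opnorm_scal|].
rewrite Rabs_pos_eq; lra.
Qed.

Lemma sqrt_iter_bound Q n :
  opnorm Q <= 1 -> opnorm (sqrt_iter Q n) <= sqrt_iter_one n.
Proof.
intros HQ; induction n as [|n IH]; simpl.
- rewrite opnorm_zero; lra.
- eapply Rle_trans; [apply opnorm_half|].
  apply Rmult_le_compat_l; [lra|].
  eapply Rle_trans; [apply opnorm_triangle|].
  pose proof (opnorm_mult (sqrt_iter Q n) (sqrt_iter Q n)).
  pose proof (opnorm_ge_0 (sqrt_iter Q n)); nra.
Qed.

(** Writing y_n for the scalar iterates, the next increment is (Y_(n+1)^2 - Y_n^2) / 2, of norm at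
    most (y_(n+1) + y_n)(y_(n+1) - y_n) / 2, which is exactly the next scalar increment. *)
Lemma sqrt_iter_step Q n :
  opnorm Q <= 1 ->
  opnorm (minus (sqrt_iter Q (S n)) (sqrt_iter Q n))
  <= sqrt_iter_one (S n) - sqrt_iter_one n.
Proof.
intros HQ; induction n as [|n IH].
- pose proof (sqrt_iter_bound Q 1 HQ).
  change (opnorm (minus (sqrt_iter Q 1) zero) <= sqrt_iter_one 1 - 0).
  rewrite Rminus_0_r, minus_zero_r; exact H0.
- pose proof (sqrt_iter_bound Q n HQ); pose proof (sqrt_iter_bound Q (S n) HQ).
  set (Y' := sqrt_iter Q (S n)) in *.
  set (y' := sqrt_iter_one (S n)) in *.
  assert (E : minus (sqrt_iter Q (S (S n))) Y'
    = scal (/ 2) (minus (mult Y' Y') (mult (sqrt_iter Q n) (sqrt_iter Q n)))).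
  { change (sqrt_iter Q (S (S n))) with (scal (/ 2) (plus Q (mult Y' Y')) : BOp H).
    apply bop_ext_re; intros x z.
    assert (EY : Y' x = bop_fun (scal (/ 2) (plus Q (mult (sqrt_iter Q n) (sqrt_iter Q n)))) x)
      by reflexivity.
    bop_expand; rewrite EY; bop_expand; field. }
  rewrite E.
  change (sqrt_iter_one (S (S n))) with (/ 2 * (1 + y' ^ 2)).
  replace y' with (/ 2 * (1 + sqrt_iter_one n ^ 2)) at 2 by reflexivity.
  eapply Rle_trans; [apply opnorm_half|].
  pose proof (opnorm_square_minus Y' (sqrt_iter Q n)).
  pose proof (opnorm_ge_0 (minus Y' (sqrt_iter Q n))).
  pose proof (sqrt_iter_one_bounds n); pose proof (sqrt_iter_one_bounds (S n)).
  fold y' in H5.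
  pose proof (opnorm_ge_0 Y'); pose proof (opnorm_ge_0 (sqrt_iter Q n)).
  assert ((opnorm Y' + opnorm (sqrt_iter Q n)) * opnorm (minus Y' (sqrt_iter Q n))
    <= (y' + sqrt_iter_one n) * (y' - sqrt_iter_one n))
    by (apply Rmult_le_compat; lra).
  nra.
Qed.

Lemma sqrt_iter_dist Q n k :
  opnorm Q <= 1 ->
  opnorm (minus (sqrt_iter Q (n + k)) (sqrt_iter Q n))
  <= sqrt_iter_one (n + k) - sqrt_iter_one n.
Proof.
intros HQ; induction k as [|k IH].
- rewrite Nat.add_0_r, minus_eq_zero, Rminus_diag; right; exact opnorm_zero.
- rewrite Nat.add_succ_r, (minus_trans (sqrt_iter Q (n + k))).
  eapply Rle_trans; [apply opnorm_triangle|].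
  pose proof (sqrt_iter_step Q (n + k) HQ); lra.
Qed.

(** The scalar iterates increase and are bounded by 1, hence Cauchy; by [sqrt_iter_dist] the
    operator iterates are Cauchy too, and the operator space is complete. *)
Lemma sqrt_iter_cv Q :
  opnorm Q <= 1 ->
  exists Y : BOp H, forall e, 0 < e ->
    exists N, forall n, (N <= n)%nat -> opnorm (minus (sqrt_iter Q n) Y) < e.
Proof.
intros HQ.
destruct (growing_cv sqrt_iter_one) as [l Hl].
- intros n; apply sqrt_iter_one_incr.
- exists 1; intros r [n ->]; apply sqrt_iter_one_bounds.
- destruct (proj1 (filterlim_locally_cauchy (U := bop_CompleteNormedModule H)
    (F := eventually) (sqrt_iter Q))) as [Y HY].
  + intros e.
    assert (He : e / 4 > 0) by (pose proof (cond_pos e); lra).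
    destruct (Hl _ He) as [N HN].
    exists (fun n => (N <= n)%nat); split; [now exists N|].
    assert (L : forall n, (N <= n)%nat ->
      opnorm (minus (sqrt_iter Q n) (sqrt_iter Q N)) < e / 2).
    { intros n Hn; replace n with (N + (n - N))%nat by lia.
      eapply Rle_lt_trans; [apply sqrt_iter_dist, HQ|].
      replace (N + (n - N))%nat with n by lia.
      pose proof (HN n Hn) as Bn; pose proof (HN N (Nat.le_refl N)) as BN.
      unfold Rdist in *.
      apply Rabs_def2 in Bn; apply Rabs_def2 in BN; lra. }
    intros u v Hu Hv; apply bop_norm_compat1.
    rewrite (minus_trans (sqrt_iter Q N)).
    eapply Rle_lt_trans; [apply opnorm_triangle|].
    rewrite (opnorm_minus_sym (sqrt_iter Q N)).
    pose proof (L u Hu); pose proof (L v Hv); lra.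
  + exists Y; intros e He.
    exact (HY _ (locally_ball Y (mkposreal e He))).
Qed.

Lemma sqrt_iter_selfadjoint Q n :
  is_adjoint Q Q -> is_adjoint (sqrt_iter Q n) (sqrt_iter Q n).
Proof.
intros HQ; induction n as [|n IH]; apply is_adjoint_re; intros x y.
- change (Re (inner (zero : H) y) = Re (inner x (zero : H))).
  rewrite (re_inner_sym y zero), !re_inner_zero_r; reflexivity.
- simpl; bop_expand; rewrite HQ, IH, IH; reflexivity.
Qed.

Lemma selfadjoint_im A (x : H) : is_adjoint A A -> Im (inner (A x) x) = 0.
Proof.
intros E; pose proof (E x x) as E1; rewrite (inner_conj H (A x) x) in E1.
apply (f_equal Im) in E1; unfold Im, Cconj in *; simpl in E1; lra.
Qed.

(** The limit Y of the iteration satisfies 2 Y = Q + Y^2, so (I - Y)^2 = I - Q, and ||Y|| <= 1 makes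
    I - Y positive. *)
Lemma positive_root_one_minus Q :
  opnorm Q <= 1 -> is_adjoint Q Q ->
  exists S : BOp H, positive_op S /\ mult S S = minus one Q.
Proof.
intros HQ AQ; destruct (sqrt_iter_cv Q HQ) as [Y HY].
assert (NY : opnorm Y <= 1).
{ apply le_epsilon; intros e He; destruct (HY e He) as [N HN].
  pose proof (HN N (Nat.le_refl N)); pose proof (sqrt_iter_bound Q N HQ).
  pose proof (sqrt_iter_one_bounds N).
  pose proof (opnorm_le_minus Y (sqrt_iter Q N)).
  rewrite opnorm_minus_sym in H3; lra. }
(* Both ||Y_N|| and ||Y|| are at most 1, so halving Y_N^2 - Y^2 leaves an error no larger than ||Y_N
   - Y||; the other e/2 comes from Y_(N+1). *)
assert (FY : Y = scal (/ 2) (plus Q (mult Y Y))).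
{ apply opnorm_eq_limit; intros e He.
  assert (He2 : 0 < e / 2) by lra.
  destruct (HY _ He2) as [N HN].
  pose proof (HN N (Nat.le_refl N)) as B0.
  pose proof (HN (S N) (Nat.le_succ_diag_r N)) as B1.
  rewrite (minus_trans (sqrt_iter Q (S N))).
  eapply Rle_trans; [apply opnorm_triangle|].
  rewrite opnorm_minus_sym.
  set (Z := sqrt_iter Q N) in *.
  replace (minus (sqrt_iter Q (S N)) (scal (/ 2) (plus Q (mult Y Y))))
    with (scal (/ 2) (minus (mult Z Z) (mult Y Y)) : BOp H)
    by (simpl; fold Z; bop_ring).
  pose proof (opnorm_half (minus (mult Z Z) (mult Y Y))).
  pose proof (opnorm_square_minus Z Y).
  pose proof (sqrt_iter_bound Q N HQ); pose proof (sqrt_iter_one_bounds N).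
  fold Z in H2; pose proof (opnorm_ge_0 (minus Z Y)); nra. }
exists (minus one Y); split.
- intros x.
  (* The iterates are self-adjoint, so their quadratic forms are real, and this passes to the norm
     limit. *)
  assert (IY : Im (inner (Y x) x) = 0).
  { apply cond_eq; intros e He; rewrite Rminus_0_r.
    set (n := norm x ^ 2); assert (Hn : 0 <= n) by apply pow2_ge_0.
    assert (Hd : 0 < e / (n + 1)) by (apply Rdiv_lt_0_compat; lra).
    destruct (HY _ Hd) as [N HN].
    pose proof (HN N (Nat.le_refl N)) as B.
    set (Z := sqrt_iter Q N) in *.
    pose proof (selfadjoint_im Z x (sqrt_iter_selfadjoint Q N AQ)) as IZ.
    replace (Im (inner (Y x) x)) with (- Im (inner (minus Z Y x) x)).
    2:{ bop_unfold; rewrite im_inner_minus_l, IZ; ring. }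
    rewrite Rabs_Ropp.
    eapply Rle_lt_trans; [apply (Rle_trans _ _ _ (Rmax_r _ _) (Rmax_Cmod _))|].
    eapply Rle_lt_trans; [apply cauchy_schwarz|].
    pose proof (norm_opnorm (minus Z Y) x).
    apply (Rmult_lt_compat_r (n + 1)) in B; [|lra].
    replace (e / (n + 1) * (n + 1)) with e in B by (field; lra).
    pose proof (opnorm_ge_0 (minus Z Y)); pose proof (norm_ge_0 x).
    unfold n in *; nra. }
  split.
  + bop_unfold; rewrite im_inner_minus_l, inner_norm, IY; simpl; ring.
  + bop_expand; rewrite re_inner_self.
    pose proof (re_inner_le (Y x) x); pose proof (norm_opnorm Y x).
    pose proof (norm_ge_0 x); nra.
- apply bop_ext_re; intros x z.
  assert (E : Re (inner (Y x) z) = / 2 * (Re (inner (Q x) z) + Re (inner (Y (Y x)) z))).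
  { rewrite FY at 1; bop_expand; reflexivity. }
  bop_expand; lra.
Qed.

Lemma positive_root_exists A :
  exists S : BOp H, positive_op S /\ mult S S = mult (adjoint A) A.
Proof.
(* The +1 keeps k invertible when A = 0. *)
set (B := adjoint A); set (k := opnorm A + 1).
pose proof (adjoint_correct A) as AB; fold B in AB.
pose proof (opnorm_ge_0 A) as A0.
assert (Hk : 0 < k) by (unfold k; lra).
set (Q := minus one (scal (/ k ^ 2) (mult B A)) : BOp H).
(* In ||Qx||^2 = ||x||^2 - 2 ||Ax||^2 / k^2 + ||A*Ax||^2 / k^4, the bound ||A*Ax|| <= k ||Ax|| makes
   the last term at most half of the subtracted one. *)
assert (NQ : opnorm Q <= 1).
{ apply opnorm_le; [lra|]; intros x; rewrite Rmult_1_l.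
  pose proof (adjoint_bound A (A x) (B (A x)) (fun u => AB u (A x))) as N.
  pose proof (norm_ge_0 (B (A x))); pose proof (norm_ge_0 (A x)).
  pose proof (norm_ge_0 x).
  assert (E : norm (Q x) ^ 2 = norm x ^ 2 - 2 * / k ^ 2 * norm (A x) ^ 2
    + / k ^ 2 * / k ^ 2 * norm (B (A x)) ^ 2).
  { rewrite <- !re_inner_self; unfold Q; bop_expand.
    rewrite (re_inner_sym x (B (A x))), <- (AB x (A x)); ring. }
  assert (B2 : norm (B (A x)) ^ 2 <= k ^ 2 * norm (A x) ^ 2).
  { rewrite <- Rpow_mult_distr; apply pow_incr; unfold k; nra. }
  assert (B3 : / k ^ 2 * norm (B (A x)) ^ 2 <= norm (A x) ^ 2).
  { apply Rmult_le_reg_l with (k ^ 2); [nra|].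
    rewrite <- Rmult_assoc, Rinv_r, Rmult_1_l; [exact B2 | nra]. }
  assert (K2 : 0 < / k ^ 2) by (apply Rinv_0_lt_compat; nra).
  apply Rnot_lt_le; intros L; nra. }
assert (AQ : is_adjoint Q Q).
{ apply is_adjoint_re; intros u y; unfold Q; bop_expand.
  rewrite <- (re_inner_sym (B (A u))), <- (AB y (A u)), <- (AB u (A y)).
  rewrite (re_inner_sym (A u)); reflexivity. }
destruct (positive_root_one_minus Q NQ AQ) as [S [SP SS]].
exists (scal k S); split.
- intros x.
  change (Im (inner (scal (RtoC k : C_AbsRing) (S x)) x) = 0
    /\ 0 <= Re (inner (scal (RtoC k : C_AbsRing) (S x)) x)).
  rewrite inner_scal_l; destruct (SP x) as [S1 S2].
  unfold Re, Im in *; simpl; nra.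
- apply bop_ext_re; intros x z.
  assert (E : Re (inner (S (S x)) z) = Re (inner (bop_fun (minus one Q) x) z))
    by (rewrite <- SS; reflexivity).
  unfold Q in E; revert E; bop_expand; intros E; rewrite E; field; lra.
Qed.

Lemma op_abs_square A : pow_n (op_abs A) 2 = mult (adjoint A) A.
Proof.
change (mult (op_abs A) (mult (op_abs A) one) = mult (adjoint A) A).
rewrite mult_one_r.
exact (proj2 (epsilon_spec (inhabits zero)
  (fun P => positive_op P /\ mult P P = mult (adjoint A) A) (positive_root_exists A))).
Qed.

End SquareRoot.

(** * Bounds on the numerical radius and evaluation of the integral *)

Section NumericalRadius.

Context {H : HilbertSpace}.
Implicit Types A T : BOp H.

(** Nonnegativity of M covers the zero space, where the supremum is [m_infty] and [numrad] takes the
    value 0. *)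
Lemma numrad_le A (M : R) :
  0 <= M -> (forall x : H, norm x = 1 -> Cmod (inner (A x) x) <= M) -> numrad A <= M.
Proof.
intros M0 HM; unfold numrad; set (E := fun r => _).
assert (U : Rbar_le (Lub_Rbar E) M).
{ apply (proj2 (Lub_Rbar_correct E)); intros r [x [Hx ->]]; exact (HM x Hx). }
destruct (Lub_Rbar E); simpl in *; tauto || lra.
Qed.

Lemma numrad_ge_0 A : 0 <= numrad A.
Proof.
unfold numrad; set (E := fun r => _).
pose proof (proj1 (Lub_Rbar_correct E)) as U.
destruct (classic (exists r, E r)) as [[r Er]|N].
- pose proof (U r Er) as Ur; destruct Er as [x [_ ->]].
  pose proof (Cmod_ge_0 (inner (A x) x)).
  destruct (Lub_Rbar E); simpl in *; lra.
- assert (L : Rbar_le (Lub_Rbar E) m_infty).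
  { apply (proj2 (Lub_Rbar_correct E)); intros r Er; elim N; exists r; exact Er. }
  destruct (Lub_Rbar E); simpl in *; tauto || lra.
Qed.

Lemma is_RInt_segment_square (T : BOp H) (c : R) :
  is_RInt (fun t : R => pow_n (plus (scal (1 - t) T) (scal (t * c) (one : BOp H))) 2) 0 1
    (scal (/ 3) (plus (mult T T) (plus (scal c T) (scal (c ^ 2) (one : BOp H))))).
Proof.
(* An antiderivative of the square expanded in T^2, T and I; each coefficient of G(1) - G(0) carries
   the factor 1/3. *)
set (G := fun (t : R) => plus (scal (- (1 - t) ^ 3 / 3) (mult T T))
  (plus (scal (c * (t ^ 2 - 2 * t ^ 3 / 3)) T)
        (scal (c ^ 2 * t ^ 3 / 3) (one : BOp H))) : BOp H).
set (g := fun (t : R) => plus (scal ((1 - t) ^ 2) (mult T T))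
  (plus (scal (c * (2 * t - 2 * t ^ 2)) T)
        (scal (c ^ 2 * t ^ 2) (one : BOp H))) : BOp H).
apply is_RInt_ext with g.
{ intros t _; unfold g.
  change (g t = mult (plus (scal (1 - t) T) (scal (t * c) (one : BOp H)))
    (mult (plus (scal (1 - t) T) (scal (t * c) (one : BOp H))) one)).
  unfold g; bop_ring. }
replace (scal (/ 3) (plus (mult T T) (plus (scal c T) (scal (c ^ 2) (one : BOp H)))))
  with (minus (G 1) (G 0)) by (unfold G; bop_ring).
apply (is_RInt_derive (V := bop_CompleteNormedModule H) G g).
- intros t _; unfold G, g.
  repeat apply (is_derive_plus (V := bop_NormedModule H));
    apply (is_derive_scal_l (V := bop_NormedModule H)); auto_derive; auto; field.
- intros t _; unfold g.
  assert (Sc : forall (f : R -> R) (U : BOp H), ex_derive f t ->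
    continuous (fun u => scal (f u) U) t).
  { intros f U Hf; apply (continuous_scal_l (V := bop_NormedModule H)).
    apply (ex_derive_continuous (V := R_NormedModule)), Hf. }
  refine (continuous_plus (V := bop_NormedModule H) _ _ t (Sc _ _ _)
    (continuous_plus (V := bop_NormedModule H) _ _ t (Sc _ _ _) (Sc _ _ _)));
    auto_derive; auto.
Qed.

End NumericalRadius.

(** * The two norm inequalities *)

Theorem corollary3p5 (H : HilbertSpace) (A : BOp H) (alpha : R)
    (halpha : 0 <= alpha <= 1) :
  let T : BOp H :=
    plus (scal alpha (pow_n (op_abs A) 2))
         (scal (1 - alpha) (pow_n (op_abs (adjoint A)) 2)) in
  let J : BOp H :=
    RInt (fun t : R =>
      pow_n (plus (scal (1 - t) T) (scal (t * numrad A ^ 2) (one : BOp H))) 2) 0 1 in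
  numrad A ^ 2 <= sqrt (opnorm J) /\ sqrt (opnorm J) <= opnorm T.
Proof.
intros T J.
set (c := numrad A ^ 2) in *.
assert (EJ : J = scal (/ 3) (plus (mult T T) (plus (scal c T) (scal (c ^ 2) (one : BOp H))))).
{ apply is_RInt_unique, is_RInt_segment_square. }
assert (ET : T = plus (scal alpha (mult (adjoint A) A))
    (scal (1 - alpha) (mult (adjoint (adjoint A)) (adjoint A)))).
{ unfold T; rewrite !op_abs_square; reflexivity. }
pose proof (adjoint_correct A) as AB; set (B := adjoint A) in *.
pose proof (adjoint_correct B) as BD; set (D := adjoint B) in *.
assert (TT : forall x y : H, Re (inner (T x) y)
    = alpha * Re (inner (A x) (A y)) + (1 - alpha) * Re (inner (B x) (B y))).
{ intros x y; rewrite ET; bop_expand.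
  rewrite (re_inner_sym y (B (A x))), <- (AB y (A x)), (re_inner_sym (A x) (A y)).
  rewrite (re_inner_sym y (D (B x))), <- (BD y (B x)), (re_inner_sym (B x) (B y)).
  reflexivity. }
assert (Tsym : forall x y : H, Re (inner (T x) y) = Re (inner x (T y))).
{ intros x y; rewrite (re_inner_sym (T y) x), !TT.
  rewrite (re_inner_sym (A x) (A y)), (re_inner_sym (B x) (B y)); reflexivity. }
assert (HT : forall x : H, norm x = 1 -> Cmod (inner (A x) x) ^ 2 <= Re (inner (T x) x)).
{ intros x Hx; rewrite TT, !re_inner_self.
  pose proof (cauchy_schwarz (A x) x) as SA.
  assert (SB : Cmod (inner (A x) x) <= norm x * norm (B x))
    by (rewrite AB; apply cauchy_schwarz).
  rewrite Hx in *.
  pose proof (Cmod_ge_0 (inner (A x) x)).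
  assert (Cmod (inner (A x) x) ^ 2 <= norm (A x) ^ 2) by (apply pow_incr; lra).
  assert (Cmod (inner (A x) x) ^ 2 <= norm (B x) ^ 2) by (apply pow_incr; lra).
  nra. }
assert (T1 : forall x : H, norm x = 1 -> Re (inner (T x) x) <= opnorm T).
{ intros x Hx; pose proof (re_inner_le (T x) x); pose proof (norm_opnorm T x).
  rewrite Hx in *; lra. }
pose proof (numrad_ge_0 A) as w0.
pose proof (opnorm_ge_0 T) as T0.
pose proof (opnorm_ge_0 J) as J0.
assert (c0 : 0 <= c) by apply pow2_ge_0.
assert (cT : c <= opnorm T).
{ rewrite <- (pow2_sqrt (opnorm T) T0); apply pow_incr; split; [exact w0|].
  apply numrad_le; [apply sqrt_pos|]; intros x Hx.
  pose proof (HT x Hx); pose proof (T1 x Hx).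
  rewrite <- (sqrt_pow2 (Cmod (inner (A x) x))) by apply Cmod_ge_0.
  apply sqrt_le_1_alt; lra. }
split.
- rewrite <- (sqrt_pow2 c c0); apply sqrt_le_1_alt.
  apply Rnot_lt_le; intros L.
  assert (cp : 0 < c) by nra.
  set (K := opnorm J) in *.
  (* A uniform bound replaces the limit s -> c: taking the supremum over unit vectors turns s <= K /
     c into c <= K / c, so c^2 <= K, contradicting [L]. *)
  assert (Hs : forall x : H, norm x = 1 -> Cmod (inner (A x) x) ^ 2 <= K / c).
  { intros x Hx.
    assert (JK : Re (inner (J x) x) <= K).
    { pose proof (re_inner_le (J x) x); pose proof (norm_opnorm J x).
      rewrite Hx in *; unfold K; lra. }
    assert (EJx : Re (inner (J x) x)
      = / 3 * (norm (T x) ^ 2 + (c * Re (inner (T x) x) + c ^ 2))).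
    { rewrite EJ; bop_expand.
      rewrite Tsym, !re_inner_self, Hx; ring. }
    pose proof (re_inner_le (T x) x) as Tx; rewrite Hx in Tx.
    pose proof (HT x Hx) as sx.
    set (s := Cmod (inner (A x) x) ^ 2) in *.
    assert (s0 : 0 <= s) by apply pow2_ge_0.
    assert (s ^ 2 <= norm (T x) ^ 2) by (apply pow_incr; lra).
    (* Since s^2 + c^2 >= 2 c s, this bound implies c s <= K. *)
    assert (Q : s ^ 2 + c * s + c ^ 2 <= 3 * K) by nra.
    apply Rmult_le_reg_r with c; [exact cp|].
    unfold Rdiv; rewrite Rmult_assoc, Rinv_l, Rmult_1_r by lra.
    assert (s < c) by nra.
    nra. }
  assert (KC : 0 <= K / c) by (apply Rle_mult_inv_pos; assumption).
  assert (cK : c <= K / c).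
  { rewrite <- (pow2_sqrt (K / c) KC); apply pow_incr; split; [exact w0|].
    apply numrad_le; [apply sqrt_pos|]; intros x Hx.
    rewrite <- (sqrt_pow2 (Cmod (inner (A x) x))) by apply Cmod_ge_0.
    apply sqrt_le_1_alt, Hs, Hx. }
  apply (Rmult_le_compat_r c) in cK; [|lra].
  unfold Rdiv in cK; rewrite Rmult_assoc, Rinv_l, Rmult_1_r in cK by lra; lra.
- rewrite <- (sqrt_pow2 (opnorm T) T0); apply sqrt_le_1_alt.
  (* Only an inequality, since the identity of the zero space has norm 0. *)
  assert (N1 : opnorm (one : BOp H) <= 1).
  { apply opnorm_le; [lra|]; intros x; bop_unfold; lra. }
  assert (Jle : opnorm J <= / 3 * (opnorm T ^ 2 + (c * opnorm T + c ^ 2))).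
  { rewrite EJ; eapply Rle_trans; [apply opnorm_scal|].
    rewrite Rabs_pos_eq by lra; apply Rmult_le_compat_l; [lra|].
    eapply Rle_trans; [apply opnorm_triangle|]; apply Rplus_le_compat.
    { pose proof (opnorm_mult T T); lra. }
    eapply Rle_trans; [apply opnorm_triangle|]; apply Rplus_le_compat.
    { pose proof (opnorm_scal c T) as S; rewrite Rabs_pos_eq in S; lra. }
    pose proof (opnorm_scal (c ^ 2) (one : BOp H)) as S.
    rewrite Rabs_pos_eq in S by apply pow2_ge_0.
    eapply Rle_trans; [exact S|]; pose proof (pow2_ge_0 c); nra. }
  (* By c <= ||T||, each of the three terms in [Jle] is at most ||T||^2. *)
  nra.
Qed.
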